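(* Let $\alpha\ge0$. If a deterministic learning-augmented algorithm for online packet scheduling with deadlines is $(1+\alpha)$-consistent, then its competitive ratio (over all real instances and all predictions) cannot be better than $\frac{2}{1+\alpha}$.
   Context: Problem: an instance is a collection $\mathcal{J}$ of unit-length jobs $j=(r_j,d_j,w_j)$ (integer release time, integer deadline, nonnegative weight), revealed online at their release times; at each integer time $t$ at most one job is processed and job $j$ may be processed at $t$ only if $r_j\le t\le d_j-1$; the goal is to maximize total processed weight. A learning-augmented algorithm additionally receives at time $0$ a predicted instance $\hat{\mathcal{J}}$. Its competitive ratio on $(\mathcal{J},\hat{\mathcal{J}})$ is $W(\textsc{Opt}(\mathcal{J}))/W(\text{its output})$, where $\textsc{Opt}(\mathcal{J})$ is an optimal offline schedule and $W$ denotes total weight. The algorithm is $\beta$-consistent if its competitive ratio is at most $\beta$ on every input whose prediction is exactly correct ($\hat{\mathcal{J}}=\mathcal{J}$). *)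

(* Defs.v *)
From HB Require Import structures.
From mathcomp Require Import all_boot all_order all_algebra.
From mathcomp Require Import finmap multiset.
From mathcomp Require Import all_classical all_reals all_analysis.

Set Implicit Arguments.
Unset Strict Implicit.
Unset Printing Implicit Defensive.
Import Order.TTheory GRing.Theory Num.Theory.

Local Open Scope classical_set_scope.
Local Open Scope mset_scope.
Local Open Scope ring_scope.

Record job (R : realType) := Job {
  release : nat;
  deadline : nat;
  weight : {nonneg R}
}.

Section JobChoice.
Variable R : realType.

Definition job_tuple (j : job R) : nat * nat * {nonneg R} :=
  (release j, deadline j, weight j).

Definition tuple_job (x : nat * nat * {nonneg R}) : job R :=
  Job x.1.1 x.1.2 x.2.

Lemma job_tupleK : cancel job_tuple tuple_job.
Proof. by case. Qed.

HB.instance Definition _ := Choice.copy (job R) (can_type job_tupleK).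

End JobChoice.

(* Several jobs may share the same parameters; such jobs are interchangeable,
   so an instance is a multiset and J j is the number of copies of j. *)
Definition instance (R : realType) := {mset job R}.

(* S t is the job processed during the time slot t, None meaning idle. *)
Definition schedule (R : realType) := nat -> option (job R).

Section Scheduling.
Variable R : realType.
Implicit Types (J Jhat : instance R) (S : schedule R) (t : nat).

Definition horizon J : nat := (\max_(j <- enum_mset J) deadline j)%N.

Definition feasible J S : Prop :=
  (forall t j, S t = Some j ->
     [/\ j \in J, (release j <= t)%N & (t < deadline j)%N]) /\
  (forall j, (#|[set t : 'I_(horizon J) | S t == Some j]%SET| <= J j)%N).

Definition slot_weight (o : option (job R)) : R :=
  if o is Some j then (weight j)%:num else 0.

(* Total processed weight: a feasible schedule idles from horizon J on. *)
Definition total_weight J S : R := \sum_(t < horizon J) slot_weight (S t).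

(* The supremum is attained, see opt_weight_attained below. *)
Definition opt_weight J : R := sup (total_weight J @` feasible J).

Lemma feasible_idle J : feasible J (fun=> None).
Proof. by split=> [//|j]; rewrite (_ : finset _ = finset.set0) ?cards0. Qed.

Lemma opt_weight_attained J :
  exists2 S, feasible J S & total_weight J S = opt_weight J.
Proof.
pose T := {ffun 'I_(horizon J) -> option (seq_sub (enum_mset J))}.
pose toS (f : T) : schedule R := fun t =>
  if insub t is Some i then omap val (f i) else None.
pose P (f : T) := `[< feasible J (toS f) >].
pose F (f : T) := total_weight J (toS f).
have toS_onto S : feasible J S -> exists f, toS f = S.
  move=> [win _].
  exists [ffun i : 'I_(horizon J) => obind insub (S i)].
  apply/funext => t; rewrite /toS; case: insubP => [i _ <-|].
    rewrite ffunE; case E: (S i) => [j|//] /=.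
    by have [jJ _ _] := win _ _ E; rewrite insubT.
  rewrite -leqNgt => ht; case E: (S t) => [j|//].
  have [jJ _ tj] := win _ _ E.
  have : (deadline j <= horizon J)%N.
    by rewrite /horizon (big_rem j) //= leq_maxl.
  by move=> /(leq_trans tj); rewrite ltnNge ht.
have [f0 Ef0] := toS_onto _ (feasible_idle J).
have Pf0 : P f0 by apply/asboolP; rewrite Ef0; exact: feasible_idle.
have [f /asboolP Pf fmax] := @arg_maxP _ _ _ f0 P F Pf0.
exists (toS f) => //.
have ubf : ubound (total_weight J @` feasible J) (F f).
  move=> _ [S fS <-]; have [g Eg] := toS_onto _ fS.
  by rewrite -Eg; apply: fmax; apply/asboolP; rewrite Eg.
apply/le_anti/andP; split.
  by apply: ub_le_sup; [exists (F f) | exists (toS f)].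
by apply: ge_sup ubf; exists (F f); exists (toS f).
Qed.

Definition revealed J t : instance R :=
  [fsfun j in finsupp J => if (release j <= t)%N then J j else 0%N].

(* The decision at time t is a function of the prediction and of the jobs
   revealed by time t. Since jobs carry their release times, those jobs
   determine everything revealed at earlier times, hence, the algorithm being
   deterministic, also its own earlier decisions. *)
Definition run (decide : instance R -> nat -> instance R -> option (job R))
    Jhat J : schedule R :=
  fun t => decide Jhat t (revealed J t).

Record online_algorithm := OnlineAlgorithm {
  decide : instance R -> nat -> instance R -> option (job R);
  run_feasible : forall Jhat J, feasible J (run decide Jhat J)
}.

Implicit Type A : online_algorithm.

Definition alg_weight A Jhat J : R := total_weight J (run (decide A) Jhat J).

(* x / 0 is +oo for x > 0. When both weights vanish the quotient is 0, so that
   such an input puts no constraint on the competitive ratio. *)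
Definition ratio A Jhat J : \bar R :=
  if (alg_weight A Jhat J == 0) && (0 < opt_weight J) then +oo%E
  else (opt_weight J / alg_weight A Jhat J)%:E.

Definition competitive_ratio A : \bar R :=
  ereal_sup [set x | exists Jhat J, x = ratio A Jhat J].

Definition consistent (beta : R) A : Prop :=
  forall J, (ratio A J J <= beta%:E)%E.

End Scheduling.

(* Main.v *)
Require Import Defs.
From mathcomp Require Import all_boot all_order all_algebra.
From mathcomp Require Import finmap multiset lra.
From mathcomp Require Import all_classical all_reals all_analysis.
Import Order.TTheory GRing.Theory Num.Theory.
Local Open Scope ring_scope.

(** Let [w > alpha] and predict an urgent job of weight [w], which must be
    processed in slot [0], and a patient job of weight [1], which may be
    processed in slot [0] or [1]. If the prediction is correct then the optimum
    is [1 + w], whereas a run that does not start with the urgent job collects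
    at most [1]; so a [(1 + alpha)]-consistent algorithm starts with the urgent
    job. It cannot yet see a third job, of weight [1], that is released at time
    [1] and has to be processed in slot [1]. With that job the optimum is at
    least [2], while the algorithm collects at most [1 + w]. The bound follows
    by letting [w] tend to [alpha]. *)

Lemma deadline_le_horizon {R : realType} (J : instance R) (j : job R) :
  j \in J -> (deadline j <= horizon J)%N.
Proof. by move=> jJ; rewrite /horizon (big_rem j) //= leq_maxl. Qed.

Lemma horizon_seq_mset {R : realType} (s : seq (job R)) :
  horizon (seq_mset s) = (\max_(j <- s) deadline j)%N.
Proof. exact/perm_big/perm_eq_seq_mset. Qed.

Lemma mem_seq_mset {R : realType} (s : seq (job R)) (j : job R) :
  (j \in seq_mset s) = (j \in s).
Proof. by rewrite in_mset mset_seqE -has_count has_pred1. Qed.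

Lemma revealedE {R : realType} (J : instance R) (t : nat) (j : job R) :
  revealed J t j = if (release j <= t)%N then J j else 0%N.
Proof.
rewrite /revealed fsfunE; case: finsuppP => // _.
by case: ifP.
Qed.

Lemma slot_weight_ge0 {R : realType} (o : option (job R)) :
  0 <= slot_weight o.
Proof. by case: o => [j|] /=. Qed.

(** A member of [J] has multiplicity at least 1, so a schedule that never repeats a job respects
    every multiplicity. *)
Lemma feasible_of_injective {R : realType} (J : instance R) (S : schedule R) :
  (forall t j, S t = Some j ->
     [/\ j \in J, (release j <= t)%N & (t < deadline j)%N]) ->
  (forall t u j, S t = Some j -> S u = Some j -> t = u) ->
  feasible J S.
Proof.
move=> win inj; split=> // j.
have [jJ|jJ] := boolP (j \in J); last first.
  rewrite (_ : finset _ = finset.set0) ?cards0 //.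
  apply/setP => t; rewrite !inE; apply/negP => /eqP /win[jJ' _ _].
  by rewrite jJ' in jJ.
rewrite in_mset in jJ; apply: leq_trans jJ.
apply/card_le1_eqP => t u; rewrite !inE => /eqP St /eqP Su.
by apply/val_inj/(inj _ _ j).
Qed.

Lemma feasible_once {R : realType} (J : instance R) (S : schedule R)
    (j : job R) (t u : nat) :
  feasible J S -> (J j <= 1)%N -> S t = Some j -> S u = Some j -> t = u.
Proof.
move=> [win cnt] Jj St Su.
have [jJ _ tj] := win _ _ St; have [_ _ uj] := win _ _ Su.
have dJ := deadline_le_horizon J j jJ.
have /card_le1_eqP inj := leq_trans (cnt j) Jj.
(* Feasibility only counts slots below the horizon; the deadline of [j] places [t] and [u] there. *)
have := inj (Ordinal (leq_trans tj dJ)) (Ordinal (leq_trans uj dJ)).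
by rewrite !inE /= St Su eqxx => /(_ isT isT) [].
Qed.

Lemma slot_weight_le_sum {R : realType} (J : instance R) (S : schedule R)
    (t : nat) :
  feasible J S ->
  slot_weight (S t) <= \sum_(j <- enum_mset J) (weight j)%:num.
Proof.
move=> [win _]; case E: (S t) => [j|] /=; last by apply: sumr_ge0.
have [jJ _ _] := win _ _ E.
by rewrite (big_rem j) //= lerDl sumr_ge0.
Qed.

Lemma le_opt_weight {R : realType} (J : instance R) (S : schedule R) :
  feasible J S -> total_weight J S <= opt_weight J.
Proof.
move=> fS; apply: ub_le_sup; last by exists S.
(* A crude bound suffices: [sup] only has to range over a bounded set. *)
exists (\sum_(t < horizon J) \sum_(j <- enum_mset J) (weight j)%:num).
move=> _ [T fT <-]; apply: ler_sum => t _.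
exact: slot_weight_le_sum.
Qed.

(** Since [0 < x], the optimum is positive, so a run of weight 0 has ratio [+oo] and not the default
    value 0. *)
Lemma le_ratio {R : realType} (A : online_algorithm R) (Jhat J : instance R)
    (x y : R) :
  0 < x -> x <= opt_weight J -> alg_weight A Jhat J <= y ->
  ((x / y)%:E <= Defs.ratio A Jhat J)%E.
Proof.
move=> x0 xopt algy; rewrite /Defs.ratio (lt_le_trans x0 xopt) andbT.
have alg0 : 0 <= alg_weight A Jhat J.
  by apply: sumr_ge0 => t _; exact: slot_weight_ge0.
case: ifPn => [_|algN0]; first by rewrite leey.
have alg_gt0 : 0 < alg_weight A Jhat J by rewrite lt_def algN0.
rewrite lee_fin ler_pM ?invr_ge0 ?(ltW x0) ?(le_trans alg0 algy) //.
by rewrite lef_pV2 // posrE // (lt_le_trans alg_gt0).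
Qed.

Lemma ratio_le_competitive_ratio {R : realType} (A : online_algorithm R)
    (Jhat J : instance R) :
  (Defs.ratio A Jhat J <= competitive_ratio A)%E.
Proof. by apply: ereal_sup_ubound; exists Jhat, J. Qed.

Definition urgent {R : realType} (w : {nonneg R}) : job R := Job 0 1 w.

Definition patient (R : realType) : job R := Job 0 2 1%:nng.

Definition late (R : realType) : job R := Job 1 2 1%:nng.

Definition predicted {R : realType} (w : {nonneg R}) : instance R :=
  seq_mset [:: urgent w; patient R].

Definition actual {R : realType} (w : {nonneg R}) : instance R :=
  seq_mset [:: urgent w; patient R; late R].

Definition two_slots {R : realType} (j k : job R) : schedule R :=
  fun t => if t is t'.+1 then if t' is 0 then Some k else None else Some j.

Lemma total_weight_predicted {R : realType} (w : {nonneg R}) (S : schedule R) :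
  total_weight (predicted w) S = slot_weight (S 0) + slot_weight (S 1).
Proof.
rewrite /total_weight horizon_seq_mset !big_cons big_nil /=.
by rewrite big_ord_recl big_ord1.
Qed.

Lemma total_weight_actual {R : realType} (w : {nonneg R}) (S : schedule R) :
  total_weight (actual w) S = slot_weight (S 0) + slot_weight (S 1).
Proof.
rewrite /total_weight horizon_seq_mset !big_cons big_nil /=.
by rewrite big_ord_recl big_ord1.
Qed.

Lemma feasible_two_slots {R : realType} (J : instance R) (j k : job R) :
  j != k -> j \in J -> k \in J -> release j = 0 -> (0 < deadline j)%N ->
  (release k <= 1 < deadline k)%N -> feasible J (two_slots j k).
Proof.
move=> jk jJ kJ rj dj /andP[rk dk]; apply: feasible_of_injective.
  by move=> [|[|t]] l //= [<-]; rewrite ?rj.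
by move=> [|[|t]] [|[|u]] l //= [jl] [kl]; rewrite jl kl eqxx in jk.
Qed.

Lemma opt_predicted_ge {R : realType} (w : {nonneg R}) :
  1 + w%:num <= opt_weight (predicted w).
Proof.
have fS : feasible (predicted w) (two_slots (urgent w) (patient R)).
  by apply: feasible_two_slots; rewrite ?mem_seq_mset ?inE ?eqxx ?orbT //.
by have := le_opt_weight _ _ fS; rewrite total_weight_predicted /= addrC.
Qed.

Lemma opt_actual_ge {R : realType} (w : {nonneg R}) :
  2 <= opt_weight (actual w).
Proof.
have fS : feasible (actual w) (two_slots (patient R) (late R)).
  by apply: feasible_two_slots; rewrite ?mem_seq_mset ?inE ?eqxx ?orbT //.
by have := le_opt_weight _ _ fS; rewrite total_weight_actual.
Qed.

(** The urgent job has expired by slot 1, so only the patient job remains for either slot, and it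
    can be processed once. *)
Lemma predicted_weight_le1 {R : realType} (w : {nonneg R}) (S : schedule R) :
  feasible (predicted w) S -> S 0 <> Some (urgent w) ->
  total_weight (predicted w) S <= 1.
Proof.
move=> fS S0; have [win _] := fS; rewrite total_weight_predicted.
have slot0 : S 0 = None \/ S 0 = Some (patient R).
  case E: (S 0) => [j|]; [right|by left].
  have [] := win _ _ E; rewrite mem_seq_mset !inE.
  by move=> /orP[] /eqP ej _ _; rewrite -?ej // in S0; rewrite ej.
have slot1 : S 1 = None \/ S 1 = Some (patient R).
  case E: (S 1) => [j|]; [right|by left].
  have [] := win _ _ E; rewrite mem_seq_mset !inE.
  by move=> /orP[] /eqP ->.
(* The deadlines differ, so the two jobs are not copies of each other even when [w] is 1. *)
have once : (predicted w (patient R) <= 1)%N.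
  by rewrite mset_seqE /= eqxx.
case: slot0 => E0; case: slot1 => E1; rewrite E0 E1 /= ?addr0 ?add0r //.
by have := feasible_once _ _ _ _ _ fS once E0 E1.
Qed.

Lemma actual_weight_le {R : realType} (w : {nonneg R}) (S : schedule R) :
  feasible (actual w) S -> S 0 = Some (urgent w) ->
  total_weight (actual w) S <= 1 + w%:num.
Proof.
move=> [win _] S0; rewrite total_weight_actual S0 /= addrC lerD2r.
case E: (S 1) => [j|] //=.
have [] := win _ _ E; rewrite mem_seq_mset !inE.
by move=> /or3P[] /eqP ->.
Qed.

Lemma revealed_actual0 {R : realType} (w : {nonneg R}) :
  revealed (actual w) 0 = revealed (predicted w) 0.
Proof.
apply/fsfunP => j; rewrite !revealedE; case: ifP => // rj.
(* The instances differ only in the late job, which is still hidden at time 0. *)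
rewrite !mset_seqE /=; case: (late R =P j) => // ej.
by rewrite -ej in rj.
Qed.

(** Any other start forces a ratio of at least [1 + w]. The strict inequality [alpha < w] is what
    makes this contradict consistency. *)
Lemma consistent_starts_urgent {R : realType} (alpha : R) (w : {nonneg R})
    (A : online_algorithm R) :
  alpha < w%:num -> consistent (1 + alpha) A ->
  run (decide A) (predicted w) (predicted w) 0 = Some (urgent w).
Proof.
move=> alphaw cons; apply: contrapT => S0.
have alg_le1 := predicted_weight_le1 _ _ (run_feasible A _ _) S0.
have opt_gt0 : 0 < 1 + w%:num by rewrite ltr_pwDl.
have := le_trans (le_ratio A _ _ _ _ opt_gt0 (opt_predicted_ge w) alg_le1)
                 (cons (predicted w)).
by rewrite divr1 lee_fin lerD2l leNgt alphaw.
Qed.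

Lemma competitive_ratio_ge {R : realType} (alpha : R) (w : {nonneg R})
    (A : online_algorithm R) :
  alpha < w%:num -> consistent (1 + alpha) A ->
  ((2 / (1 + w%:num))%:E <= competitive_ratio A)%E.
Proof.
move=> alphaw cons.
apply: le_trans (ratio_le_competitive_ratio A (predicted w) (actual w)).
apply: le_ratio => //; first exact: opt_actual_ge.
apply: actual_weight_le; first exact: run_feasible.
rewrite /run revealed_actual0; exact: (consistent_starts_urgent alpha).
Qed.

Theorem theorem3 (R : realType) (alpha : R) (A : online_algorithm R) :
  0 <= alpha ->
  consistent (1 + alpha) A ->
  ((2 / (1 + alpha))%:E <= competitive_ratio A)%E.
Proof.
move=> alpha0 cons.
have bound w : alpha < w -> ((2 / (1 + w))%:E <= competitive_ratio A)%E.
  move=> alphaw; have w0 : 0 <= w by exact: le_trans (ltW alphaw).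
  exact: (competitive_ratio_ge alpha (NngNum w0)).
(* One arbitrary instance of the bound rules out [-oo] and shows that a finite competitive ratio [r]
   is positive. *)
have := bound (alpha + 1); rewrite ltrDl ltr01 => /(_ isT).
case: (competitive_ratio A) bound => [r| |] bound //; last by rewrite !leey.
rewrite lee_fin => r_ge.
have r_gt0 : 0 < r by apply: lt_le_trans r_ge; rewrite divr_gt0 //; lra.
rewrite lee_fin ler_pdivrMr; last by lra.
(* In the form [2 / r <= 1 + alpha], the limit needs no continuity: slack [e] on the right is the
   bound at [w = alpha + e]. *)
rewrite mulrC -ler_pdivrMr //; apply/ler_addgt0Pr => e e0.
have := bound (alpha + e); rewrite ltrDl e0 lee_fin => /(_ isT).
by rewrite !ler_pdivrMr ?addrA ?(mulrC r) //; lra.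
Qed.
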